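(* Let $(G,\cdot)$ be a finite group such that $\mathrm{Aut}(G)$ is abelian, and let $N,M\le \mathrm{Hol}(G)$ be regular subgroups. Denote by $\gamma\colon G\to \mathrm{Aut}(G)$ and $\delta\colon G\to\mathrm{Aut}(G)$ the gamma functions, and by $\circ$ and $\bullet$ the circle operations, associated with $N$ and $M$ respectively. Then $N$ and $M$ mutually normalize each other in $\mathrm{Sym}(G)$ if and only if $$\begin{cases}\gamma(h)=\gamma\left(h\cdot (g\circ h)^{-1}\cdot (h\bullet g)\right)\\ \delta(h)=\delta\left(h\cdot (g\bullet h)^{-1}\cdot (h\circ g)\right)\end{cases}\qquad\text{for all } g,h\in G,$$ where $(\,\cdot\,)^{-1}$ denotes the inverse with respect to the original operation $\cdot$ of $G$.
   Context: Maps act on the right: $x^\alpha$ is the image of $x$ under $\alpha$, and products of permutations are composed left to right. For a group $G$, $\rho\colon G\to\mathrm{Sym}(G)$, $\rho(g)\colon x\mapsto xg$, is the right regular representation, and the (permutational) holomorph is $\mathrm{Hol}(G)=\langle \rho(G),\mathrm{Aut}(G)\rangle\le \mathrm{Sym}(G)$. A subgroup $N\le\mathrm{Hol}(G)$ is regular if it acts regularly on the set $G$. A gamma function on $G$ is a map $\gamma\colon G\to\mathrm{Aut}(G)$ with $\gamma(g^{\gamma(h)}\cdot h)=\gamma(g)\gamma(h)$ for all $g,h\in G$. Regular subgroups $N\le \mathrm{Hol}(G)$ correspond bijectively to gamma functions $\gamma$ on $G$ via $N=\{\gamma(g)\rho(g): g\in G\}$, where $\gamma(g)\rho(g)$ is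 the unique element of $N$ mapping $1$ to $g$. The circle operation associated with $N$ (or $\gamma$) is the group operation on $G$ given by $g\circ h=g^{\gamma(h)}\cdot h$. Two subgroups $N,M\le\mathrm{Sym}(G)$ mutually normalize each other if $N$ is contained in the normalizer of $M$ in $\mathrm{Sym}(G)$ and $M$ is contained in the normalizer of $N$ in $\mathrm{Sym}(G)$. *)

(* Defs.v *)
From mathcomp Require Import all_boot all_fingroup.

Set Implicit Arguments.
Unset Strict Implicit.
Unset Printing Implicit Defensive.

Import GroupScope.

(* The group G is the whole type gT, so that Sym(G) is {perm gT}. The product *)
(* of permutations is composed left to right (permM), and a permutation s     *)
(* sends x to s x, which is x ^ s in right-action notation.                   *)

Section Holomorph.

Variable gT : finGroupType.
Implicit Types (g h x : gT) (gamma : gT -> {perm gT}) (N : {group {perm gT}}).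

Definition rho g : {perm gT} := actperm 'R g.

Definition holomorph : {group {perm gT}} :=
  <<(rho @: [set: gT]) :|: Aut [set: gT]>>%G.

Definition regular N : Prop :=
  [transitive N, on [set: gT] | 'P] /\ (forall x, 'C_N[x | 'P] = 1).

Definition circle gamma g h : gT := gamma h g * h.

Definition gamma_function gamma : Prop :=
  (forall g, gamma g \in Aut [set: gT]) /\
  (forall g h, gamma (circle gamma g h) = gamma g * gamma h).

Definition gamma_of N gamma : Prop :=
  gamma_function gamma /\ N :=: [set gamma g * rho g | g : gT].

Definition mutually_normalize (N M : {group {perm gT}}) : Prop :=
  N \subset 'N(M) /\ M \subset 'N(N).

(* Every regular subgroup of the holomorph has exactly one gamma function.    *)

Lemma rhoE g x : rho g x = x * g.
Proof. by rewrite /rho actpermE. Qed.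

Lemma autE (a : {perm gT}) : a \in Aut [set: gT] -> {morph a : x y / x * y}.
Proof.
by move=> Aa x y; rewrite -!(autmE Aa) morphM // inE.
Qed.

Lemma aut1E (a : {perm gT}) : a \in Aut [set: gT] -> a 1 = 1.
Proof. by move=> Aa; rewrite -(autmE Aa) morph1. Qed.

Lemma holomorph_decomp n :
  n \in holomorph -> n * (rho (n 1))^-1 \in Aut [set: gT].
Proof.
have rhoM g h : rho (g * h) = rho g * rho h.
  by apply/permP=> x; rewrite permM !rhoE mulgA.
have rhoJ a g : a \in Aut [set: gT] -> rho g * a = a * rho (a g).
  by move=> Aa; apply/permP=> x; rewrite !permM !rhoE autE.
pose H := [set a * rho g | a in Aut [set: gT], g in [set: gT]].
have gH : group_set H.
  apply/group_setP; split.
    apply/imset2P; exists (1 : {perm gT}) (1 : gT); rewrite ?group1 ?in_setT //.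
    by apply/permP=> x; rewrite permM rhoE !perm1 mulg1.
  move=> _ _ /imset2P[a g Aa _ ->] /imset2P[b h Ab _ ->].
  apply/imset2P; exists (a * b) (b g * h); rewrite ?in_setT ?groupM //.
  by rewrite rhoM -!mulgA; congr (_ * _); rewrite !mulgA rhoJ.
have /subsetP sub: holomorph \subset Group gH.
  rewrite gen_subG subUset; apply/andP; split; apply/subsetP=> s.
    case/imsetP=> g _ ->; apply/imset2P; exists (1 : {perm gT}) g => //.
    by rewrite mul1g.
  move=> As; apply/imset2P; exists s (1 : gT); rewrite ?in_setT //.
  by apply/permP=> x; rewrite permM rhoE mulg1.
move=> /sub /imset2P[a g Aa _ ->]; rewrite permM rhoE aut1E // mul1g.
by rewrite mulgK.
Qed.

Lemma gamma_of_exists N :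
  N \subset holomorph -> regular N -> exists gamma, gamma_of N gamma.
Proof.
move=> /subsetP sNH [trN stN].
have inj1 : {in N &, injective (fun n : {perm gT} => n 1)}.
  move=> m n Nm Nn /= eq1; apply/eqP; rewrite eq_mulgV1.
  suff: m * n^-1 \in 'C_N[(1 : gT) | 'P] by rewrite stN => /set1P ->.
  by rewrite inE groupM ?groupV //=; apply/astab1P; rewrite /= /aperm permM eq1 permK.
have ex g : exists n, (n \in N) && (n 1 == g).
  have: g \in orbit 'P N 1 by rewrite (atransP trN) ?inE.
  by case/orbitP=> n Nn <-; exists n; rewrite Nn /=.
pose nu g := xchoose (ex g).
have nuP g : nu g \in N /\ nu g 1 = g.
  by case/andP: (xchooseP (ex g)) => ? /eqP.
pose gamma g := nu g * (rho g)^-1.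
have Ag g : gamma g \in Aut [set: gT].
  by have [Nn n1] := nuP g; have := holomorph_decomp (sNH _ Nn); rewrite n1.
have nuE g : gamma g * rho g = nu g by rewrite mulgKV.
clearbody gamma.
have nuM g h : nu g * nu h = nu (gamma h g * h).
  have [Ngh e] := nuP (gamma h g * h).
  apply: inj1; rewrite ?groupM // ?(nuP g).1 ?(nuP h).1 //.
  by rewrite permM (nuP g).2 e -nuE permM rhoE.
exists gamma; split; first (split=> // g h).
  apply: (mulIg (rho (gamma h g * h))); rewrite nuE -nuM -(nuE g) -(nuE h).
  apply/permP=> x; rewrite !permM !rhoE (autE (Ag h)).
  by rewrite mulgA.
apply/setP=> n; apply/idP/imsetP=> [Nn | [g _ ->]]; last first.
  by rewrite nuE (nuP g).1.
by exists (n 1) => //; apply: inj1; rewrite ?nuE ?(nuP _).1 ?(nuP _).2.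
Qed.

Lemma gamma_of_unique N gamma gamma' :
  gamma_of N gamma -> gamma_of N gamma' -> gamma =1 gamma'.
Proof.
move=> [[Ag _] NE] [[Ag' _] NE'] g.
have: gamma g * rho g \in N by rewrite NE; apply: imset_f.
rewrite NE' => /imsetP[h _ e]; have := congr1 (fun s : {perm gT} => s 1) e.
rewrite !permM !rhoE !aut1E // !mul1g => gh.
by rewrite -gh in e; apply: mulIg e.
Qed.

End Holomorph.

(* Main.v *)
Require Import Defs.
From mathcomp Require Import all_boot all_fingroup.

Import GroupScope.

(** In the holomorph every element factors uniquely as an automorphism followed
    by a right translation.
    Write nu h = gamma h * rho h and mu g = delta g * rho g for the elements of
    N and M.  The group M normalizes N exactly when, for all g and h, the
    equation nu h * mu g = mu g * nu k has a solution k.  Both sides are in the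
    holomorph, so the equation splits (lemma [aut_rho_inj]).
    - The automorphism parts are gamma h * delta g and delta g * gamma k; since
      Aut(G) is abelian they agree exactly when gamma k = gamma h.
    - The translation parts are the images of 1, namely the circle products
      circle delta h g and circle gamma g k = gamma k g * k.
    Given gamma k = gamma h, the second equation reads
    gamma h g * k = circle delta h g, and as
    gamma h g = circle gamma g h * h^-1 it has the single solution
    k = h * (circle gamma g h)^-1 * circle delta h g.  So M normalizes N if and
    only if gamma takes the same value at h and at this k: this is
    [normalizes_gammaP].  The theorem is that lemma used for both orders of the
    pair (N, M). *)

Section AutTimesRho.

Variable gT : finGroupType.
Implicit Types (a b : {perm gT}) (g h k : gT) (gamma delta : gT -> {perm gT}).

Lemma aut_rho_inj a b g h :
    a \in Aut [set: gT] -> b \in Aut [set: gT] ->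
  a * rho g = b * rho h -> a = b /\ g = h.
Proof.
move=> Aa Ab eq_ab; have := congr1 (fun s : {perm gT} => s 1) eq_ab.
rewrite !permM !rhoE !aut1E // !mul1g => eq_gh; split=> //.
by apply: (mulIg (rho g)); rewrite eq_ab eq_gh.
Qed.

Lemma aut_rho_mul a b g h :
  b \in Aut [set: gT] -> (a * rho g) * (b * rho h) = (a * b) * rho (b g * h).
Proof.
by move=> Ab; apply/permP=> x; rewrite !permM !rhoE Defs.autE // mulgA.
Qed.

(** This solves gamma h g * k = circle delta h g for k. *)
Lemma circle_quotientE gamma delta g h k :
  (gamma h g * k == circle delta h g) =
  (k == h * (circle gamma g h)^-1 * circle delta h g).
Proof.
rewrite {2}/circle invMg mulKVg.
exact: can2_eq (mulKg (gamma h g)) (mulKVg _) _ _.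
Qed.

(** One half of mutual normalization.  It compares nu h * mu g with
    mu g * nu k, a form of conjugation that avoids inverses in the
    holomorph. *)
Lemma normalizes_gammaP (N M : {group {perm gT}}) gamma delta :
    abelian (Aut [set: gT]) -> gamma_of N gamma -> gamma_of M delta ->
  M \subset 'N(N) <->
  (forall g h : gT,
     gamma h = gamma (h * (circle gamma g h)^-1 * circle delta h g)).
Proof.
move=> /centsP cA [[Ag _] defN] [[Ad _] defM].
split=> [/subsetP nNM g h | eq_gamma].
  have Mg: delta g * rho g \in M by rewrite defM; apply: imset_f.
  have: (gamma h * rho h) ^ (delta g * rho g) \in N.
    by rewrite memJ_norm ?nNM // defN; apply: imset_f.
  rewrite defN => /imsetP[k _ /(congr1 (mulg (delta g * rho g)))].
  rewrite -conjgC !aut_rho_mul // => /aut_rho_inj[]; rewrite ?groupM //.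
  rewrite (cA _ (Ag h) _ (Ad g)) => /mulgI eq_hk /esym/eqP.
  by rewrite -eq_hk circle_quotientE => /eqP <-.
apply/subsetP=> m; rewrite defM => /imsetP[g _ ->]; rewrite inE.
apply/subsetP=> _ /imsetP[n + ->]; rewrite [in n \in _]defN => /imsetP[h _ ->].
set k := h * (circle gamma g h)^-1 * circle delta h g.
have eq_hk: gamma h = gamma k := eq_gamma g h.
have /eqP def_k: gamma h g * k == circle delta h g by rewrite circle_quotientE.
rewrite defN; apply/imsetP; exists k => //.
apply: (mulgI (delta g * rho g)); rewrite -conjgC !aut_rho_mul //.
by rewrite -eq_hk def_k (cA _ (Ag h) _ (Ad g)).
Qed.

End AutTimesRho.

Theorem theorem4p27 (gT : finGroupType)
    (abA : abelian (Aut [set: gT]))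
    (N M : {group {perm gT}})
    (sNH : N \subset holomorph gT) (regN : regular N)
    (sMH : M \subset holomorph gT) (regM : regular M)
    (gamma delta : gT -> {perm gT})
    (gammaN : gamma_of N gamma) (deltaM : gamma_of M delta) :
  mutually_normalize N M <->
  (forall g h : gT,
     gamma h = gamma (h * (circle gamma g h)^-1 * circle delta h g) /\
     delta h = delta (h * (circle delta g h)^-1 * circle gamma h g)).
Proof.
have nNM := normalizes_gammaP _ _ _ _ _ abA gammaN deltaM.
have nMN := normalizes_gammaP _ _ _ _ _ abA deltaM gammaN.
split=> [[/nMN eq_delta /nNM eq_gamma] g h | eqs]; first by split.
by split; [apply/nMN | apply/nNM] => g h; have [] := eqs g h.
Qed.
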